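(* Let $G$ be a finite abelian group and let $X, Y, Z$ be subgroups of $G$ with equal odd index in $G$. Then $X, Y, Z$ share a common transversal in $G$.
   Context: A transversal of a subgroup $H$ in an abelian group $G$ is a subset of $G$ containing exactly one element from each coset of $H$ in $G$. A common transversal of $X, Y, Z$ in $G$ is a subset of $G$ that is simultaneously a transversal of $X$, of $Y$ and of $Z$ in $G$. *)

(* Defs.v *)
From mathcomp Require Import all_boot all_fingroup.

Set Implicit Arguments.
Unset Strict Implicit.
Unset Printing Implicit Defensive.

(* In an abelian group left and right cosets coincide; [rcosets H G] is the
   set of cosets of H by elements of G, and [is_transversal] requires T to be
   a subset of G meeting each of them in exactly one element. *)
Definition coset_transversal (gT : finGroupType) (G H : {group gT})
    (T : {set gT}) : bool :=
  is_transversal T (rcosets H G) G.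

Definition common_transversal3 (gT : finGroupType) (G X Y Z : {group gT})
    (T : {set gT}) : bool :=
  [&& coset_transversal G X T, coset_transversal G Y T
    & coset_transversal G Z T].

(* Main.v *)
Require Import Defs.
From mathcomp Require Import all_boot all_fingroup all_solvable.
From mathcomp Require Import zify.

(** Call a set T separated modulo H when distinct elements of T lie in distinct
    cosets of H.  A separated subset of G with #|G : H| elements is a
    transversal of H in G, so a common transversal of X, Y, Z is a subset of G
    of the right cardinality that is separated modulo X, Y and Z at once.  Such
    sets are assembled as products along chains of subgroups: if H <= K, a
    subset of K separated modulo H times a set separated modulo K is separated
    modulo H ([separatedM]), and cardinalities multiply.  Write N for the
    intersection of X, Y and Z.

    The abelian group G is the direct product of its Sylow p-subgroup and of a
    p'-group; subgroups split accordingly, and the product of a common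
    transversal in each factor is one in G.  So G may be taken to be a p-group
    ([common_separated_abelian]), where the proof is an induction on the index.

    Suppose first that none of the three pairwise intersections equals N.  Then
    there are x in Y and Z but not in X, y in X and Z but not in Y, and z in X
    and Y but not in Z, all three with p-th powers in N.  The product
    g = x * y * z lies outside X, Y and Z, while g ^+ p lies in N, so that the
    cyclic group of g meets X, Y and Z in the same subgroup, generated by
    g ^+ p.  A transversal of the latter in the former, multiplied by a common
    transversal of X<g>, Y<g>, Z<g>, which have smaller index, does the job
    ([common_separated_pgroup]).

    Otherwise Y and Z, say, meet in N.  Put K = YZ and enlarge the intersection
    of X and K to a subgroup L of K with #|L| = #|X|.  A common transversal of
    L, Y, Z in K is then spread over the cosets of K, correcting the
    representatives of these cosets, taken in X, by elements of L
    ([common_separated_pgroup_meet]).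

    There remains the case G = YZ with Y and Z meeting in N
    ([common_separated_complement]).  When X meets Y and Z trivially, it is the
    graph y |-> z of an isomorphism between subgroups of Y and Z, and the
    antigraph of all y * z^-1 meets X trivially, because squaring is injective
    modulo X; this is where the odd index comes in ([ex_antigraph]).  In general
    the antigraph is taken modulo (X :&: Y) <*> (X :&: Z), and the two
    intersections are used up by pairing their elements with representatives of
    the cosets of XZ and XY in G ([ex_complement_pairing]).  *)

Set Implicit Arguments.
Unset Strict Implicit.
Unset Printing Implicit Defensive.

(** * Index computations *)

(** For [ex_complement_pairing]: x, c, b, g, w, k are the orders of X,
    Y :&: Z, X :&: Z, G, X <*> Z and Y :&: (X <*> Z), while i and j are the
    indices of the last group in Y and of Y :&: Z in X :&: Z.  *)
Lemma pairing_count x i j k w c b g : 0 < x -> 0 < w -> 0 < c ->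
  k * i = x -> c * j = b -> x * x = g * c -> x * x = w * b -> x * w = g * k ->
  i = j.
Proof.
move=> x0 w0 c0 ik jc e1 e2 e3; apply/eqP; rewrite -(eqn_pmul2r w0).
have -> : j * w = g.
  by apply/eqP; rewrite -(eqn_pmul2r c0) -e1 e2 -jc; apply/eqP; lia.
by rewrite -(eqn_pmul2l x0) mulnCA e3 -ik; apply/eqP; lia.
Qed.

(** For [common_separated_complement]: s, p, q are the sizes of the three factors
    and h is the index of X; x, a, b, c, g, m are the orders of X, X :&: Y,
    X :&: Z, Y :&: Z, G and (X :&: Y) <*> (X :&: Z).  *)
Lemma transversal_count x s p q a b c g h m : 0 < x -> 0 < c ->
  m * s = x -> x * h = g -> c * q = a -> c * p = b ->
  x * x = g * c -> a * b = m * c -> p * s * q = h.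
Proof.
move=> x0 c0 e1 e2 e3 e4 e5 e6; apply/eqP; rewrite -(eqn_pmul2r c0).
have -> : h * c = x.
  by apply/eqP; rewrite -(eqn_pmul2l x0) mulnA e2 -e5.
have em : m = p * q * c.
  by apply/eqP; rewrite -(eqn_pmul2r c0) -e6 -e3 -e4; apply/eqP; lia.
by rewrite -e1 em; apply/eqP; lia.
Qed.

(** For [common_separated_pgroup_meet]: k, r, m are the sizes of the three factors
    and h is the index of X; x, o, n, w, g are the orders of X, X :&: K, K,
    K <*> X and G.  *)
Lemma pgroup_count x k r m o w n g h : 0 < x -> 0 < o ->
  x * k = n -> o * r = x -> w * m = g -> n * x = w * o -> x * h = g ->
  k * r * m = h.
Proof.
move=> x0 o0 e1 e2 e3 e4 e5; apply/eqP; rewrite -(eqn_pmul2l x0) e5.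
have -> : x * (k * r * m) = x * k * r * m by rewrite !mulnA.
rewrite e1 -(eqn_pmul2r o0).
have -> : n * r * m * o = n * (o * r) * m by lia.
by rewrite e2 e4 -e3; apply/eqP; lia.
Qed.

Local Open Scope group_scope.

(** * Separated sets *)

Section Separated.

Variable gT : finGroupType.
Implicit Types (A B S T : {set gT}) (G H K L U V W X Y Z : {group gT}).

Definition separated (A S : {set gT}) : Prop :=
  {in S &, forall s t, s * t^-1 \in A -> s = t}.

Lemma separated_subset A B S T :
  A \subset B -> S \subset T -> separated B T -> separated A S.
Proof.
move=> sAB sST sepT s t Ss St st.
by apply: sepT; rewrite ?(subsetP sST) // (subsetP sAB).
Qed.

(** For a subset of G only the trace of A on G matters, since all the quotients
    s * t^-1 stay in G.  *)
Lemma separatedI A G S : S \subset G -> separated (A :&: G) S -> separated A S.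
Proof.
move=> sSG sepS s t Ss St st; apply: sepS => //.
by rewrite inE st groupM ?groupV ?(subsetP sSG).
Qed.

(** A difference of products modulo H can be read modulo K first, which
    identifies the factors in T, and then modulo H, which identifies those in S.
    This is the transitivity of transversals along H <= K.  *)
Lemma separatedM H K S T :
  H \subset K -> S \subset K -> separated K T -> separated H S ->
  separated H (S * T) /\ #|S * T| = (#|S| * #|T|)%N.
Proof.
move=> sHK sSK sepT sepS.
have key s s' t t' : s \in S -> s' \in S -> t \in T -> t' \in T ->
    s * t * (s' * t')^-1 \in H -> s = s' /\ t = t'.
  move=> Ss Ss' Tt Tt' e.
  have Et : t = t'.
    apply: sepT => //; rewrite -(groupMl _ (subsetP sSK _ Ss)).
    rewrite -(groupMr _ (groupVr (subsetP sSK _ Ss'))).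
    by move/(subsetP sHK): e; rewrite invMg !mulgA.
  split=> //; apply: sepS => //; move: e.
  by rewrite Et invMg !mulgA mulgK.
split.
  move=> _ _ /mulsgP[s t Ss Tt ->] /mulsgP[s' t' Ss' Tt' ->] /key.
  by case=> // -> ->.
rewrite [S * T]curry_imset2X card_in_imset ?cardsX //.
move=> [s t] [s' t'] /setXP[/= Ss Tt] /setXP[/= Ss' Tt'] e.
by case: (key s s' t t') => // [|-> ->] //; rewrite e mulgV group1.
Qed.

Lemma separated_imset (I : finType) (D : {set I}) (f : I -> gT) H :
    {in D &, forall i j, f i * (f j)^-1 \in H -> i = j} ->
  separated H (f @: D) /\ #|f @: D| = #|D|.
Proof.
move=> injf; split.
  by move=> _ _ /imsetP[i Di ->] /imsetP[j Dj ->] /injf ->.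
by apply: card_in_imset => i j Di Dj e; apply: injf; rewrite // e mulgV.
Qed.

Lemma ex_separated H K : H \subset K ->
  exists T : {set gT}, [/\ T \subset K, separated H T & #|T| = #|K : H|].
Proof.
move=> sHK; exists (repr @: rcosets H K).
have [|sepR cR] := @separated_imset _ (rcosets H K) repr H; last split=> //.
  move=> _ _ /rcosetsP[x Kx ->] /rcosetsP[y Ky ->] e.
  by rewrite -(rcoset_repr H x) -(rcoset_repr H y); apply/rcoset_eqP; rewrite mem_rcoset.
apply/subsetP=> _ /imsetP[_ /rcosetsP[x Kx ->] ->].
have := mem_repr_rcoset H x; apply: subsetP.
by rewrite mul_subG ?sub1set.
Qed.

Lemma separated_transversal G H T : H \subset G -> T \subset G ->
  separated H T -> #|T| = #|G : H| -> is_transversal T (rcosets H G) G.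
Proof.
move=> sHG sTG sepT cT.
have injT : {in T &, injective (fun t => H :* t)}.
  move=> s t Ts Tt /= e; apply: sepT => //.
  by rewrite -mem_rcoset -e rcoset_refl.
have eT : (fun t => H :* t) @: T = rcosets H G.
  apply/eqP; rewrite eqEcard (card_in_imset injT) cT leqnn andbT.
  by apply/subsetP=> _ /imsetP[t Tt ->]; rewrite mem_rcosets mulSGid ?(subsetP sTG).
rewrite /is_transversal rcosets_partition // sTG.
apply/'forall_implyP => B; rewrite -eT => /imsetP[t Tt ->].
apply/cards1P; exists t; apply/setP=> s; rewrite !inE mem_rcoset.
apply/andP/eqP => [[Ts /sepT ->] // | ->]; by rewrite Tt mulgV.
Qed.

(** Changing the elements of A by factors in U does not affect separation modulo
    U, and changing those of B by factors in V does not affect it modulo V.  So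
    any bijection between A and B yields products that are separated modulo
    both groups.  *)
Lemma separated_pairing A B U V : A \subset 'N(U) ->
    A \subset V -> B \subset U -> separated U A -> separated V B ->
    #|A| = #|B| ->
  exists P : {set gT}, [/\ P \subset A * B, #|P| = #|A|, separated U P & separated V P].
Proof.
move=> nUA sAV sBU sepA sepB cAB.
(* The bijection from A to B matches their enumerations. *)
pose f a := a * nth 1 (enum B) (index a (enum A)).
have fB a : a \in A -> nth 1 (enum B) (index a (enum A)) \in B.
  by move=> Aa; rewrite -mem_enum mem_nth // -cardE -cAB cardE index_mem mem_enum.
have [|sepU cP] := @separated_imset _ A f U.
  move=> a b Aa Ab; rewrite /f invMg !mulgA => e; apply: sepA => //.
  have na : a^-1 \in 'N(U) by rewrite groupV (subsetP nUA).
  set u := nth _ _ _ in e; set v := nth _ _ (index b _) in e.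
  have Uuv : (u * v^-1) ^ a^-1 \in U.
    by rewrite memJ_norm // groupM ?groupV // (subsetP sBU) ?fB.
  by rewrite -(groupMl _ Uuv) /conjg invgK !mulgA mulgKV.
have [|sepV _] := @separated_imset _ A f V.
  move=> a b Aa Ab; rewrite /f invMg !mulgA => e.
  have Va : a \in V by apply: (subsetP sAV).
  have Vb : b \in V by apply: (subsetP sAV).
  have : nth 1 (enum B) (index a (enum A)) = nth 1 (enum B) (index b (enum A)).
    apply: sepB; rewrite ?fB //.
    by move: e; rewrite groupMr ?groupV // -!mulgA groupMl.
  have i_lt c : c \in A -> index c (enum A) < size (enum B).
    by move=> Ac; rewrite -cardE -cAB cardE index_mem mem_enum.
  move/eqP; rewrite nth_uniq ?enum_uniq ?i_lt // => /eqP/index_inj ->;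
    by rewrite ?mem_enum.
exists (f @: A); split; rewrite ?cP //.
by apply/subsetP=> _ /imsetP[a Aa ->]; rewrite mem_mulg ?fB.
Qed.

(** * The case of two complementary subgroups *)

Lemma odd_index_expg2 G X x : X <| G -> odd #|G : X| -> x \in G ->
  x ^+ 2 \in X -> x \in X.
Proof.
case/andP=> sXG nXG oddi Gx x2.
have Nx : x \in 'N(X) by apply: (subsetP nXG).
have Nx2 : x ^+ 2 \in 'N(X) by rewrite groupX.
rewrite coset_idr //; apply/eqP; rewrite -order_eq1 -dvdn1.
have /eqnP <- : coprime 2 #|G : X| by rewrite coprime2n.
rewrite dvdn_gcd order_dvdn -morphX //= coset_id // eqxx /=.
by rewrite -card_quotient // order_dvdG // mem_quotient.
Qed.

Lemma abelian_joinE G X Y : abelian G -> X \subset G -> Y \subset G ->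
  X <*> Y = X * Y.
Proof. by move=> abG sXG sYG; rewrite cent_joinEr // (sub_abelian_cent2 abG). Qed.

(** S consists of the y * z^-1 for y * z running over a transversal of
    (X :&: Y) <*> (X :&: Z) in X.  Two such elements differ by y * z^-1 with
    y * z in X again; whichever of the three subgroups this difference lies in,
    y must lie in X, so that y * z lies in (X :&: Y) <*> (X :&: Z).  For the
    subgroup X this holds because (y * z) * (y * z^-1) = y ^+ 2.  *)
Lemma ex_antigraph G X Y Z :
    abelian G -> X \subset G -> Y \subset G -> Z \subset G ->
    Y * Z = G -> Y :&: Z \subset X -> odd #|G : X| ->
  exists S : {set gT},
    [/\ S \subset (X <*> Y) :&: (X <*> Z),
        #|S| = #|X : (X :&: Y) <*> (X :&: Z)|,
        separated X S,
        separated (Y <*> (X :&: Z)) S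
      & separated (Z <*> (X :&: Y)) S].
Proof.
move=> abG sXG sYG sZG eG sYZX oddX.
set A := X :&: Y; set B := X :&: Z.
have sAX : A \subset X by apply: subsetIl.
have sBX : B \subset X by apply: subsetIl.
have sABX : A <*> B \subset X by rewrite join_subG sAX.
have cG x y : x \in G -> y \in G -> x * y = y * x by move=> Gx Gy; apply: (centsP abG).
have [D [sDX sepD cD]] := ex_separated sABX.
have in_AB y z : y \in Y -> z \in Z -> y * z \in X -> y \in X -> y * z \in A <*> B.
  move=> Yy Zz Xyz Xy; rewrite groupM // mem_gen // !inE ?Yy ?Zz ?Xy ?andbT //=.
  by apply/orP; right; rewrite -(groupMl _ Xy).
(* As the index of X is odd, y is in X as soon as y ^+ 2 is. *)
have diag y z : y \in Y -> z \in Z -> y * z \in X ->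
    y * z^-1 \in X -> y * z \in A <*> B.
  move=> Yy Zz Xyz Xyz'; apply: in_AB => //.
  have Gy := subsetP sYG _ Yy; have Gz := subsetP sZG _ Zz.
  apply: (@odd_index_expg2 G) => //; first by rewrite -(sub_abelian_normal _ abG).
  by have := groupM Xyz' Xyz; rewrite (cG y z) // -mulgA mulKg.
have offY y z : y \in Y -> z \in Z -> y * z \in X ->
    y * z^-1 \in Y <*> B -> y * z \in A <*> B.
  move=> Yy Zz Xyz; rewrite (abelian_joinE abG) ?(subset_trans sBX) //.
  case/mulsgP=> y1 b Yy1 /setIP[Xb Zb] e; apply: in_AB => //.
  suff Xz : z \in X by rewrite -(groupMr _ Xz).
  rewrite -groupV -(groupMr _ (groupVr Xb)) (subsetP sYZX) // inE.
  rewrite [_ \in Z]groupM ?groupV // andbT -[z^-1](mulKg y) e mulgA mulgK.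
  by rewrite groupM ?groupV.
have offZ y z : y \in Y -> z \in Z -> y * z \in X ->
    y * z^-1 \in Z <*> A -> y * z \in A <*> B.
  move=> Yy Zz Xyz; rewrite joingC (abelian_joinE abG) ?(subset_trans sAX) //.
  case/mulsgP=> a z1 /setIP[Xa Ya] Zz1 e; apply: in_AB => //.
  rewrite -(groupMl _ (groupVr Xa)) (subsetP sYZX) // inE.
  rewrite [_ \in Y]groupM ?groupV //=.
  have -> : a^-1 * y = z1 * z by rewrite -[y](mulgKV z) e -mulgA mulKg.
  by rewrite groupM.
pose f x := divgr Y Z x * (remgr Y Z x)^-1.
have divG x : x \in X -> x \in Y * Z by rewrite eG; apply: (subsetP sXG).
have sepf H : (forall y z, y \in Y -> z \in Z -> y * z \in X -> y * z^-1 \in H ->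
    y * z \in A <*> B) -> separated H (f @: D) /\ #|f @: D| = #|D|.
  move=> offH; apply: separated_imset => s t Ds Dt; rewrite /f => e.
  have Xs := subsetP sDX _ Ds; have Xt := subsetP sDX _ Dt.
  apply: sepD => //; move: e.
  have := divgr_eq Y Z s; have := divgr_eq Y Z t.
  have := mem_divgr (divG _ Xs); have := mem_divgr (divG _ Xt).
  have := mem_remgr (divG _ Xs); have := mem_remgr (divG _ Xt).
  move: (divgr Y Z s) (divgr Y Z t) (remgr Y Z s) (remgr Y Z t) => y y' z z'.
  move=> Zz' Zz Yy' Yy et es.
  have [Gy Gy'] := (subsetP sYG _ Yy, subsetP sYG _ Yy').
  have [Gz Gz'] := (subsetP sZG _ Zz, subsetP sZG _ Zz').
  have -> : y * z^-1 * (y' * z'^-1)^-1 = y * y'^-1 * (z * z'^-1)^-1.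
    rewrite !invMg !invgK -!mulgA; congr (_ * _).
    by rewrite !mulgA (cG _ y'^-1) ?groupM ?groupV // -!mulgA (cG z') ?groupV.
  have est : s * t^-1 = y * y'^-1 * (z * z'^-1).
    rewrite es et invMg -!mulgA; congr (_ * _).
    by rewrite !mulgA (cG _ y'^-1) ?groupM ?groupV // mulgA.
  by rewrite est => e; apply: offH e; rewrite -?est groupM ?groupV.
have [sX cfD] := sepf X diag; have [sY _] := sepf _ offY; have [sZ _] := sepf _ offZ.
exists (f @: D); split; rewrite ?cfD //.
apply/subsetP=> _ /imsetP[x Dx ->]; have Xx := subsetP sDX _ Dx.
have := divgr_eq Y Z x; rewrite /f.
have := mem_divgr (divG _ Xx); have := mem_remgr (divG _ Xx).
move: (divgr Y Z x) (remgr Y Z x) => y z Zz Yy ex.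
rewrite inE; apply/andP; split.
  have -> : y * z^-1 = x^-1 * y ^+ 2.
    rewrite ex invMg -mulgA mulKg cG ?groupV ?(subsetP sYG _ Yy) //.
    exact: (subsetP sZG).
  by rewrite groupM ?groupV ?groupX // mem_gen // inE ?Xx ?Yy ?orbT.
have -> : y * z^-1 = x * z^-2 by rewrite ex expgS expg1 invMg !mulgA mulgK.
by rewrite groupM ?groupV ?groupX // mem_gen // inE ?Xx ?Zz ?orbT.
Qed.

(** For n the common index of A, B, C in G, these T are the common transversals;
    see [separated_transversal].  *)
Definition common_separated (A B C : {set gT}) G (n : nat) : Prop :=
  exists T : {set gT},
    [/\ T \subset G, #|T| = n, separated A T, separated B T & separated C T].

(** Pairs the representatives of the cosets of XZ in G, chosen in Y, with those of
    the cosets of Y in Y <*> (X :&: Z), chosen in X :&: Z.  They are equally many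
    because #|X| = #|Y| = #|Z|.  *)
Lemma ex_complement_pairing G X Y Z :
    abelian G -> X \subset G -> Y \subset G -> Z \subset G ->
    #|X| = #|Y| -> #|X| = #|Z| -> Y * Z = G -> Y :&: Z \subset X ->
  exists P : {set gT},
    [/\ P \subset Y <*> (X :&: Z), #|P| = #|X :&: Z : Y :&: Z|,
        separated (X <*> Z) P & separated Y P].
Proof.
move=> abG sXG sYG sZG cXY cXZ eG sYZX.
have sXZG : X <*> Z \subset G by rewrite join_subG sXG.
have [A [sAY sepA cA]] := ex_separated (subsetIl Y (X <*> Z)).
have sYZ : Y :&: Z \subset X :&: Z by rewrite subsetI sYZX subsetIr.
have [B [sBXZ sepB cB]] := ex_separated sYZ.
have sepA' : separated (X <*> Z) A.
  by apply: (separatedI sAY); rewrite setIC.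
have sepB' : separated Y B.
  apply: (separatedI sBXZ); apply: separated_subset sepB => //.
  by rewrite setICA subsetIr.
have nA : A \subset 'N(X <*> Z).
  apply: subset_trans (subset_trans sAY sYG) _.
  exact: sub_abelian_norm.
have sBU : B \subset X <*> Z.
  by apply: subset_trans sBXZ _; rewrite subIset // joing_subl.
have cAB : #|A| = #|B|.
  rewrite cA cB.
  have eYXZ : Y * (X <*> Z) = G.
    apply/eqP; rewrite eqEsubset mul_subG //= -{1}eG mulgS //.
    exact: joing_subr.
  have := mul_cardG Y (X <*> Z); have := mul_cardG X Z; have := mul_cardG Y Z.
  have := Lagrange sYZ; have := Lagrange (subsetIl Y (X <*> Z)).
  rewrite eYXZ eG -(abelian_joinE abG) // -cXY -cXZ.
  have := cardG_gt0 X; have := cardG_gt0 (X <*> Z).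
  have := cardG_gt0 (Y :&: Z) => c0 w0 x0 ik jc e1 e2 e3.
  exact: pairing_count x0 w0 c0 ik jc e1 e2 e3.
have [P [sP cP sepPU sepPV]] := separated_pairing nA sAY sBU sepA' sepB' cAB.
exists P; split=> //; last by rewrite cP cAB.
apply: subset_trans sP _; rewrite mul_subG //.
  exact: subset_trans sAY (joing_subl _ _).
exact: subset_trans sBXZ (joing_subr _ _).
Qed.

(** With P and Q the two pairings and S the antigraph, the product of the three
    sets is transversal along each of the chains
      Y <= Y <*> (X :&: Z) <= X <*> Y <= G, through P, S, Q;
      Z <= Z <*> (X :&: Y) <= X <*> Z <= G, through Q, S, P;
      X <= (X <*> Y) :&: (X <*> Z) <= X <*> Y <= G, through S, P, Q.  *)
Lemma common_separated_complement G X Y Z :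
    abelian G -> X \subset G -> Y \subset G -> Z \subset G ->
    #|X| = #|Y| -> #|X| = #|Z| -> Y * Z = G -> Y :&: Z \subset X ->
    odd #|G : X| ->
  common_separated X Y Z G #|G : X|.
Proof.
move=> abG sXG sYG sZG cXY cXZ eG sYZX oddX.
have [P [sP cP sepPXZ sepPY]] := ex_complement_pairing abG sXG sYG sZG cXY cXZ eG sYZX.
have eG' : Z * Y = G by rewrite -eG (centC (sub_abelian_cent2 abG _ _)).
have sZYX : Z :&: Y \subset X by rewrite setIC.
have [Q [sQ cQ sepQXY sepQZ]] := ex_complement_pairing abG sXG sZG sYG cXZ cXY eG' sZYX.
have [S [sS cS sepSX sepSY sepSZ]] := ex_antigraph abG sXG sYG sZG eG sYZX oddX.
have sYXY : Y <*> (X :&: Z) \subset X <*> Y.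
  by rewrite join_subG joing_subr subIset // joing_subl.
have sZXZ : Z <*> (X :&: Y) \subset X <*> Z.
  by rewrite join_subG joing_subr subIset // joing_subl.
have [sSXY sSXZ] := subsetIP sS.
have sPXY := subset_trans sP sYXY; have sQXZ := subset_trans sQ sZXZ.
have sXYG : X <*> Y \subset G by rewrite join_subG sXG.
have sXZG : X <*> Z \subset G by rewrite join_subG sXG.
have sPG := subset_trans sPXY sXYG; have sQG := subset_trans sQXZ sXZG.
have sSG := subset_trans sSXY sXYG.
have com (C D : {set gT}) : C \subset G -> D \subset G -> C * D = D * C.
  by move=> sC sD; apply: centC; apply: sub_abelian_cent2 sC sD.
have [sepY1 cPS] := separatedM (joing_subl _ _) sP sepSY sepPY.
have [sepY _] := separatedM (joing_subr X Y) (mul_subG sPXY sSXY) sepQXY sepY1.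
have [sepZ1 _] := separatedM (joing_subl _ _) sQ sepSZ sepQZ.
have [sepZ _] := separatedM (joing_subr X Z) (mul_subG sQXZ sSXZ) sepPXZ sepZ1.
have sXE : X \subset (X <*> Y) :&: (X <*> Z) by rewrite subsetI !joing_subl.
have sepPE := separated_subset (subsetIr (X <*> Y) (X <*> Z)) (subxx P) sepPXZ.
have [sepX1 _] := separatedM sXE sS sepPE sepSX.
have [sepX cT] := separatedM (joing_subl X Y) (mul_subG sSXY sPXY) sepQXY sepX1.
exists (S * P * Q); split=> //.
- by rewrite !mul_subG.
- rewrite cT (com S P) // cPS cP cQ cS (setIC Z).
  have sYZ : Y :&: Z \subset X :&: Z by rewrite subsetI sYZX subsetIr.
  have sZY : Y :&: Z \subset X :&: Y by rewrite subsetI sYZX subsetIl.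
  have sABX : (X :&: Y) <*> (X :&: Z) \subset X by rewrite join_subG !subsetIl.
  have eN : (X :&: Y) :&: (X :&: Z) = Y :&: Z.
    by rewrite -setIIr; apply/setIidPr.
  have := mul_cardG (X :&: Y) (X :&: Z); have := mul_cardG Y Z.
  have := Lagrange sYZ; have := Lagrange sZY; have := Lagrange sXG.
  have := Lagrange sABX.
  rewrite eN eG -(abelian_joinE abG) ?subIset ?sXG // -cXY -cXZ.
  have := cardG_gt0 X; have := cardG_gt0 (Y :&: Z).
  move=> c0 x0 e1 e2 e3 e4 e5 e6.
  exact: transversal_count x0 c0 e1 e2 e3 e4 e5 e6.
- by rewrite (com S P).
by rewrite (com _ Q) ?mul_subG // mulgA.
Qed.

(** * Abelian p-groups *)

Lemma pgroup_ex_between p n H K :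
    prime p -> p.-group K -> abelian K -> H \subset K -> #|H| %| n -> n %| #|K| ->
  exists L : {group gT}, [/\ H \subset L, L \subset K & #|L| = n].
Proof.
move=> p_pr pK abK sHK dHn dnK.
have nHK : H <| K by rewrite -(sub_abelian_normal _ abK).
have [d nE] := dvdnP dHn.
have d_dvd : d %| #|K / H|.
  rewrite card_quotient ?normal_norm // -(dvdn_pmul2l (cardG_gt0 H)).
  by rewrite Lagrange // mulnC -nE.
have pKH := quotient_pgroup H pK.
have /p_natP[r dE] := pnat_dvd d_dvd pKH.
have [|L [sL _ cL]] := @normal_pgroup p _ r _ _ pKH (normal_refl _).
  by rewrite -pfactor_dvdn ?cardG_gt0 // -dE.
exists (coset H @*^-1 L)%G; split.
- exact: sub_cosetpre.
- by rewrite sub_cosetpre_quo.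
by rewrite /= card_cosetpre cL nE mulnC dE.
Qed.

(** T solves the problem for L, Y, Z in K = Y <*> Z, where L contains X :&: K.
    Pairing the cosets of X :&: K in X with those in L gives a set R separated
    modulo K, as its elements agree with representatives in X, and modulo X, as
    they agree with representatives in L.  Modulo Y and Z the product T * R is
    read along Y <= K <= K <*> X; modulo X it is read as R * T along
    X <= X <*> L <= K <*> X, where T is separated modulo X <*> L because this
    group meets K in L.  Finally M represents the cosets of K <*> X in G.  *)
Lemma common_separated_pgroup_meet p G X Y Z :
    prime p -> p.-group G -> abelian G -> X \subset G -> Y \subset G -> Z \subset G ->
    #|X| = #|Y| -> #|X| = #|Z| -> Y :&: Z \subset X -> odd #|G : X| ->
  common_separated X Y Z G #|G : X|.
Proof.
move=> p_pr pG abG sXG sYG sZG cXY cXZ sYZX oddX.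
pose K := Y <*> Z; pose X0 := X :&: K.
have sYK : Y \subset K by apply: joing_subl.
have sZK : Z \subset K by apply: joing_subr.
have sKG : K \subset G by rewrite join_subG sYG.
have abK := abelianS sKG abG; have pK := pgroupS sKG pG.
have [L [sX0L sLK cL]] : exists L : {group gT},
    [/\ X0 \subset L, L \subset K & #|L| = #|X|].
  apply: (pgroup_ex_between p_pr pK) => //; first exact: subsetIr.
    by rewrite cardSg ?subsetIl.
  by rewrite cXY cardSg.
have sLG := subset_trans sLK sKG.
have [|||||T [sTK cT sepL sepY sepZ]] :=
    @common_separated_complement K L Y Z abK sLK sYK sZK; rewrite ?cL //.
- exact: (esym (abelian_joinE abG sYG sZG)).
- apply: subset_trans sX0L; rewrite subsetI sYZX.
  by rewrite subIset // sYK.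
- have := oddX; rewrite -!divgS // cL cXY !divgS // -(Lagrange_index sKG sYK).
  by rewrite oddM => /andP[].
have [D [sDX sepD cD]] := ex_separated (subsetIl X K).
have [S [sSL sepS cS]] := ex_separated sX0L.
have sepDK : separated K D by apply: (separatedI sDX); rewrite setIC.
have sepSX : separated X S.
  by apply: (separatedI sSL); apply: separated_subset sepS => //; rewrite setIS.
have nDK : D \subset 'N(K).
  by apply: subset_trans (subset_trans sDX sXG) _; apply: sub_abelian_norm.
have cDS : #|D| = #|S| by rewrite cD cS -!divgS ?subsetIl // cL.
have sSK := subset_trans sSL sLK.
have [R [sR cR sepRK sepRX]] := separated_pairing nDK sDX sSK sepDK sepSX cDS.
have sKXG : K <*> X \subset G by rewrite join_subG sKG.
have [M [sMG sepM cM]] := ex_separated sKXG.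
have sRXL : R \subset X <*> L.
  apply: subset_trans sR _; rewrite mul_subG //.
    exact: subset_trans sDX (joing_subl _ _).
  exact: subset_trans sSL (joing_subr _ _).
have sXLKX : X <*> L \subset K <*> X.
  by rewrite join_subG joing_subr (subset_trans sLK) ?joing_subl.
have sRKX := subset_trans sRXL sXLKX.
have sTKX := subset_trans sTK (joing_subl K X).
have [sepY1 cTR] := separatedM sYK sTK sepRK sepY.
have [sepZ1 _] := separatedM sZK sTK sepRK sepZ.
have sYKX := subset_trans sYK (joing_subl K X).
have sZKX := subset_trans sZK (joing_subl K X).
have [sepY2 cTRM] := separatedM sYKX (mul_subG sTKX sRKX) sepM sepY1.
have [sepZ2 _] := separatedM sZKX (mul_subG sTKX sRKX) sepM sepZ1.
have sepXL : separated (X <*> L) T.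
  apply: (separatedI sTK); apply: separated_subset sepL => //=.
  rewrite joingC (abelian_joinE abG) // -group_modl // mul_subG //.
have [sepX1 _] := separatedM (joing_subl X L) sRXL sepXL sepRX.
have [sepX2 _] := separatedM (joing_subr K X) (mul_subG sRKX sTKX) sepM sepX1.
have sTG := subset_trans sTK sKG; have sRG := subset_trans sRKX sKXG.
exists (T * R * M); split=> //; first by rewrite !mul_subG.
  rewrite cTRM cTR cT cR cD cM.
  have := mul_cardG K X; rewrite -(abelian_joinE abG) // setIC => e4.
  have := Lagrange sLK; rewrite cL => e1.
  exact: pgroup_count (cardG_gt0 X) (cardG_gt0 _) e1
    (Lagrange (subsetIl X K)) (Lagrange sKXG) e4 (Lagrange sXG).
by rewrite (centC (sub_abelian_cent2 abG sTG sRG)).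
Qed.

(** Among the iterated p-th powers of an element of H outside X, the last one
    outside X.  *)
Lemma pgroup_ex_expg_mem (p : nat) H X : p.-group H -> ~~ (H \subset X) ->
  exists x, [/\ x \in H, x \notin X & x ^+ p \in X].
Proof.
move=> pH /subsetPn[x Hx nXx].
have exk : exists k, x ^+ (p ^ k) \in X.
  have [k ok] := p_natP (mem_p_elt pH Hx : p.-nat #[x]).
  by exists k; rewrite -ok expg_order.
case: (ex_minnP exk) => -[|k] Xk mink; first by rewrite expn0 expg1 (negPf nXx) in Xk.
exists (x ^+ (p ^ k)); split; first by rewrite groupX.
  by apply/negP => /mink; rewrite ltnn.
by rewrite -expgM mulnC -expnS.
Qed.

(** The intersection is proper in the cycle of x and contains the cycle of
    x ^+ p, which has prime index there.  *)
Lemma cycle_setI_expg p x X : prime p -> p.-elt x -> x \notin X ->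
  x ^+ p \in X -> <[x]> :&: X = <[x ^+ p]>.
Proof.
move=> p_pr px nXx Xxp.
have sC : <[x ^+ p]> \subset <[x]> by rewrite cycle_subG mem_cycle.
have ntx : <[x]> != 1.
  by apply: contraNneq nXx => /eqP; rewrite cycle_eq1 => /eqP->.
have [_ p_dvd _] := pgroup_pdiv px ntx.
have /maxgroupP[_ maxC] : maximal <[x ^+ p]> <[x]>.
  apply: p_index_maximal => //.
  by rewrite -divgS // -!orderE orderXdiv // divnA // mulKn ?order_gt0.
have /maxC -> // : (<[x]> :&: X)%G \proper <[x]>.
  by rewrite properE subsetIl subsetI subxx cycle_subG.
by rewrite subsetI sC cycle_subG.
Qed.

(** If one pairwise intersection lies in the third subgroup, the previous case
    applies, up to permuting X, Y, Z.  Otherwise each of x, y, z below lies in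
    exactly two of the subgroups, so their product g lies in none.  *)
Lemma common_separated_pgroup p G X Y Z :
    prime p -> p.-group G -> abelian G ->
    X \subset G -> Y \subset G -> Z \subset G ->
    #|X| = #|Y| -> #|X| = #|Z| -> odd #|G : X| ->
  common_separated X Y Z G #|G : X|.
Proof.
move=> p_pr pG abG; move: {2}_.+1 (ltnSn #|G : X|) => n.
elim: n X Y Z => // n IHn X Y Z ltXn sXG sYG sZG cXY cXZ oddX.
have [sYZX | nYZX] := boolP (Y :&: Z \subset X).
  exact: common_separated_pgroup_meet p_pr pG abG sXG sYG sZG cXY cXZ sYZX oddX.
have eXY : #|G : X| = #|G : Y| by rewrite -!divgS // cXY.
have eXZ : #|G : X| = #|G : Z| by rewrite -!divgS // cXZ.
have [sXZY | nXZY] := boolP (X :&: Z \subset Y).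
  have [||||T [sTG cT sY sX sZ]] := common_separated_pgroup_meet p_pr pG abG sYG sXG sZG.
  - by rewrite cXY.
  - by rewrite -cXY.
  - by [].
  - by rewrite -eXY.
  by exists T; split; rewrite // cT eXY.
have [sXYZ | nXYZ] := boolP (X :&: Y \subset Z).
  have [||||T [sTG cT sZ sX sY]] := common_separated_pgroup_meet p_pr pG abG sZG sXG sYG.
  - by rewrite cXZ.
  - by rewrite -cXZ.
  - by [].
  - by rewrite -eXZ.
  by exists T; split; rewrite // cT eXZ.
have pI H K : H \subset G -> p.-group (H :&: K).
  by move=> sA; apply: pgroupS pG; rewrite subIset ?sA.
have [x [/setIP[Yx Zx] nXx Xx]] := pgroup_ex_expg_mem (pI Y Z sYG) nYZX.
have [y [/setIP[Xy Zy] nYy Yy]] := pgroup_ex_expg_mem (pI X Z sXG) nXZY.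
have [z [/setIP[Xz Yz] nZz Zz]] := pgroup_ex_expg_mem (pI X Y sXG) nXYZ.
have Gx := subsetP sYG _ Yx; have Gy := subsetP sXG _ Xy.
have Gz := subsetP sXG _ Xz.
pose g := x * y * z.
have Gg : g \in G by rewrite !groupM.
have nXg : g \notin X by rewrite !groupMr.
have nYg : g \notin Y by rewrite groupMr // groupMl.
have nZg : g \notin Z by rewrite groupMl // groupM.
have gpE : g ^+ p = x ^+ p * y ^+ p * z ^+ p.
  have cG u v : u \in G -> v \in G -> commute u v by move=> Gu; apply: (centsP abG).
  by rewrite !expgMn //; apply: cG; rewrite ?groupM.
have Xgp : g ^+ p \in X by rewrite gpE !groupM // groupX.
have Ygp : g ^+ p \in Y by rewrite gpE !groupM // groupX.
have Zgp : g ^+ p \in Z by rewrite gpE !groupM // groupX.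
have pg := mem_p_elt pG Gg.
have eX := cycle_setI_expg p_pr pg nXg Xgp.
have eY := cycle_setI_expg p_pr pg nYg Ygp.
have eZ := cycle_setI_expg p_pr pg nZg Zgp.
have sLG : <[g]> \subset G by rewrite cycle_subG.
have sCL : <[g ^+ p]> \subset <[g]> by rewrite cycle_subG mem_cycle.
have [S [sSL sepS cS]] := ex_separated sCL.
have cJ W : W \subset G -> <[g]> :&: W = <[g ^+ p]> ->
    (#|W <*> <[g]>| * #|<[g ^+ p]>| = #|W| * #|<[g]>|)%N.
  by move=> sWG eW; rewrite (abelian_joinE abG) // mul_cardG setIC eW.
have cXYJ : #|X <*> <[g]>| = #|Y <*> <[g]>|.
  apply/eqP; rewrite -(eqn_pmul2r (cardG_gt0 <[g ^+ p]>)).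
  by rewrite !cJ // cXY.
have cXZJ : #|X <*> <[g]>| = #|Z <*> <[g]>|.
  apply/eqP; rewrite -(eqn_pmul2r (cardG_gt0 <[g ^+ p]>)).
  by rewrite !cJ // cXZ.
have sJG W : W \subset G -> W <*> <[g]> \subset G by rewrite join_subG => ->.
have cJX : (#|G : X <*> <[g]>| * #|<[g]> : <[g ^+ p]>| = #|G : X|)%N.
  rewrite -(Lagrange_index (sJG _ sXG) (joing_subl _ _)); congr (_ * _)%N.
  apply/eqP; rewrite -(eqn_pmul2l (cardG_gt0 X)) Lagrange ?joing_subl //.
  by rewrite -(eqn_pmul2r (cardG_gt0 <[g ^+ p]>)) cJ // -mulnA (mulnC #|_ : _|) Lagrange.
have i_gt1 : 1 < #|<[g]> : <[g ^+ p]>|.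
  rewrite indexg_gt1 cycle_subG; apply: contra nXg; apply: subsetP.
  by rewrite cycle_subG.
have [||||T [sTG cT sepX sepY sepZ]] := IHn _ _ _ _ (sJG _ sXG) (sJG _ sYG) (sJG _ sZG).
- by rewrite -ltnS (leq_trans _ ltXn) // ltnS -cJX ltn_Pmulr.
- by [].
- by [].
- by move: oddX; rewrite -cJX oddM => /andP[].
have sep W : <[g]> :&: W = <[g ^+ p]> -> separated (W <*> <[g]>) T ->
    separated W (S * T) /\ #|S * T| = (#|S| * #|T|)%N.
  move=> eW; move/separatedM; apply; first exact: joing_subl.
    exact: subset_trans sSL (joing_subr _ _).
  by apply: (separatedI sSL); rewrite setIC eW.
exists (S * T); split.
- by rewrite mul_subG // (subset_trans sSL).
- by rewrite (sep _ eX sepX).2 cS cT mulnC.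
- exact: (sep _ eX sepX).1.
- exact: (sep _ eY sepY).1.
- exact: (sep _ eZ sepZ).1.
Qed.

(** * Reduction to p-groups *)

Lemma common_separated_abelian G X Y Z :
    abelian G -> X \subset G -> Y \subset G -> Z \subset G ->
    #|X| = #|Y| -> #|X| = #|Z| -> odd #|G : X| ->
  common_separated X Y Z G #|G : X|.
Proof.
move: {2}_.+1 (ltnSn #|G|) => n.
elim: n G X Y Z => // n IHn G X Y Z ltGn abG sXG sYG sZG cXY cXZ oddX.
have [G1 | ntG] := eqVneq #|G| 1%N.
  exists 1; split; rewrite ?sub1G // ?cards1; try by move=> s t /set1P-> /set1P->.
  by apply/esym/eqP; rewrite -dvdn1 -G1 dvdn_indexg.
pose p := pdiv #|G|.
have p_pr : prime p by rewrite pdiv_prime // ltn_neqAle eq_sym ntG cardG_gt0.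
pose P := 'O_p(G)%G; pose Q := 'O_p^'(G)%G.
have nilG := abelian_nil abG.
have hallP : p.-Hall(G) P := nilpotent_pcore_Hall p nilG.
have hallQ : p^'.-Hall(G) Q := nilpotent_pcore_Hall p^' nilG.
have sPG : P \subset G by apply: pcore_sub.
have sQG : Q \subset G by apply: pcore_sub.
have pP : p.-group P by apply: pcore_pgroup.
have pQ : p^'.-group Q by apply: pcore_pgroup.
have cIP W : W \subset G -> #|P :&: W| = (#|W|`_p)%N.
  move=> sWG; apply: card_Hall; apply: setI_normal_Hall hallP sWG.
  by rewrite -(sub_abelian_normal _ abG).
have cIQ W : W \subset G -> #|Q :&: W| = (#|W|`_p^')%N.
  move=> sWG; apply: card_Hall; apply: setI_normal_Hall hallQ sWG.
  by rewrite -(sub_abelian_normal _ abG).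
have cidx : (#|Q : Q :&: X| * #|P : P :&: X| = #|G : X|)%N.
  apply/eqP; rewrite -(eqn_pmul2l (cardG_gt0 X)) Lagrange //.
  rewrite -{1}(partnC p (cardG_gt0 X)) -cIP // -cIQ // (mulnC #|Q : _|) mulnACA.
  rewrite !Lagrange ?subsetIl // (card_Hall hallP) (card_Hall hallQ).
  by rewrite partnC ?cardG_gt0.
have /andP[oddQ oddP] : odd #|Q : Q :&: X| && odd #|P : P :&: X| by rewrite -oddM cidx.
have [||||||T [sTP cT sepTX sepTY sepTZ]] :=
  @common_separated_pgroup p P (P :&: X)%G (P :&: Y)%G (P :&: Z)%G
    p_pr pP (abelianS sPG abG);
  rewrite ?subsetIl //= ?cIP ?cXY // -?cXY -?cXZ //.
have [|||||||S [sSQ cS sepSX sepSY sepSZ]] :=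
  IHn Q (Q :&: X)%G (Q :&: Y)%G (Q :&: Z)%G _ (abelianS sQG abG);
  rewrite ?subsetIl //= ?cIQ ?cXY // -?cXY -?cXZ //.
  rewrite -ltnS (leq_trans _ ltGn) // ltnS (card_Hall hallQ).
  rewrite -{2}(partnC p (cardG_gt0 G)) ltn_Pmull ?part_gt0 ?p_part_gt1 //.
  by rewrite pi_pdiv ltn_neqAle eq_sym ntG cardG_gt0.
have sepM W : W \subset G -> separated (P :&: W) T -> separated (Q :&: W) S ->
    separated W (S * T) /\ #|S * T| = (#|S| * #|T|)%N.
  move=> sWG sepT sepS; apply: (@separatedM W (W <*> Q)).
  - exact: joing_subl.
  - exact: subset_trans sSQ (joing_subr _ _).
  (* An element w * q of P, with w in W and q in Q, is the p-part of w. *)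
  - apply: (separatedI sTP); apply: separated_subset sepT => //=.
    rewrite subsetI subsetIr (abelian_joinE abG) //.
    apply/subsetP=> _ /setIP[/mulsgP[w q Ww Qq ->] Pwq].
    rewrite -(constt_p_elt (mem_p_elt pP Pwq)) consttM.
      rewrite (constt1P (mem_p_elt pQ Qq)) mulg1.
      by apply: subsetP (cycle_constt p w); rewrite cycle_subG.
    exact: (centsP abG _ (subsetP sWG _ Ww) _ (subsetP sQG _ Qq)).
  by apply: (separatedI sSQ); rewrite setIC.
exists (S * T); split.
- by rewrite mul_subG // (subset_trans sSQ, subset_trans sTP).
- by rewrite (sepM X sXG sepTX sepSX).2 cS cT.
- exact: (sepM X sXG sepTX sepSX).1.
- exact: (sepM Y sYG sepTY sepSY).1.
- exact: (sepM Z sZG sepTZ sepSZ).1.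
Qed.

End Separated.

Theorem corollary1 (gT : finGroupType) (G X Y Z : {group gT})
    (abG : abelian G)
    (sXG : X \subset G) (sYG : Y \subset G) (sZG : Z \subset G)
    (eqXY : #|G : X|%g = #|G : Y|%g) (eqXZ : #|G : X|%g = #|G : Z|%g)
    (oddX : odd #|G : X|%g) :
  exists T : {set gT}, common_transversal3 G X Y Z T.
Proof.
have card_eq (W : {group gT}) : W \subset G -> #|G : X| = #|G : W| -> #|X| = #|W|.
  move=> sWG eqXW; apply/eqP; rewrite -(eqn_pmul2r (indexg_gt0 G X)).
  by rewrite {2}eqXW !Lagrange.
have [T [sTG cT sepX sepY sepZ]] := common_separated_abelian abG sXG sYG sZG
  (card_eq Y sYG eqXY) (card_eq Z sZG eqXZ) oddX.
exists T; apply/and3P; split; apply: separated_transversal => //.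
  by rewrite cT.
by rewrite cT.
Qed.
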